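(* Let $q$ be an odd prime power, let $k\in\{3,4,5\}$ and $n=2k$. Let $s$ be an integer with $0<s<2k$ and $\gcd(s,2k)=1$, and let $\eta\in\mathbb{F}_{q^n}$ be a non-square in $\mathbb{F}_{q^n}$. Define \[ \mathcal{T}_{n,s,\eta}=\Big\{(x,y)\mapsto \mathrm{Tr}\Big(b_0x^{q^{k}}y+b_1\big(x^{q^{s(k-1)}}y+y^{q^{s(k-1)}}x\big)+\eta b_2\big(x^{q^{s(k-2)}}y+y^{q^{s(k-2)}}x\big)\Big) : b_0,b_2\in\mathbb{F}_{q^k},\ b_1\in\mathbb{F}_{q^{2k}}\Big\}, \] a set of symmetric $\mathbb{F}_q$-bilinear forms on $\mathbb{F}_{q^n}$. Then $\mathcal{T}_{n,s,\eta}$ is a maximum $\mathbb{F}_q$-linear $(n-2)$-code in $\mathscr{S}_n(q)$; that is, it is an $\mathbb{F}_q$-subspace of $\mathscr{S}_n(q)$ with exactly $q^{2n}$ elements such that every nonzero element has rank at least $n-2$.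
   Context: $\mathrm{Tr}$ denotes the absolute trace from $\mathbb{F}_{q^n}$ to $\mathbb{F}_q$. $\mathscr{S}_n(q)$ denotes the set of symmetric $\mathbb{F}_q$-bilinear forms on an $n$-dimensional $\mathbb{F}_q$-vector space (here $\mathbb{F}_{q^n}$). The rank of a bilinear form is the rank of its Gram matrix with respect to any $\mathbb{F}_q$-basis. A subset $\mathcal{C}\subseteq\mathscr{S}_n(q)$ with at least two elements is a $d$-code if $\mathrm{rank}(A-B)\ge d$ for all distinct $A,B\in\mathcal{C}$; it is additive if it is a subgroup under addition. An additive $d$-code is called maximum if $|\mathcal{C}|=q^{n(n-d+2)/2}$ when $n-d$ is even, and $|\mathcal{C}|=q^{(n+1)(n-d+1)/2}$ when $n-d$ is odd (these are the largest possible sizes for additive $d$-codes). For $d=n-2$ the bound is $q^{2n}$. *)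

(* Defs.v *)
From HB Require Import structures.
From mathcomp Require Import all_boot all_order all_fingroup all_algebra all_solvable all_field.
From mathcomp Require Import ring.

Set Implicit Arguments.
Unset Strict Implicit.
Unset Printing Implicit Defensive.

Import GRing.Theory.
Local Open Scope ring_scope.

Section BilinearForms.

Variables (F : finFieldType) (V : vectType F).

(* Bilinear forms in curried form; [finvect_type] is the library alias which
   equips a vector space over a finite field with its finType structure, so
   that sets of forms have cardinalities. *)
Definition bilform : predArgType := finvect_type 'Hom(V, 'Hom(V, F^o)).
HB.instance Definition _ := Vector.on bilform.
HB.instance Definition _ := Finite.on bilform.

Definition bfeval (B : bilform) (x y : V) : F :=
  (B : 'Hom(V, 'Hom(V, F^o))) x y.

(* Meaningful when [f] is bilinear, see [bilform_ofE]; [Tform_funE] covers the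
   forms used below. *)
Definition bilform_of (f : V -> V -> F) : bilform :=
  (linfun (fun x : V => linfun (f x : V -> F^o)) : 'Hom(V, 'Hom(V, F^o))).

Definition sym_bilforms : {set bilform} :=
  [set B | [forall x : finvect_type V, forall y : finvect_type V,
     bfeval B x y == bfeval B y x]].

Definition gram (m : nat) (e : m.-tuple V) (B : bilform) : 'M[F]_m :=
  \matrix_(i, j) bfeval B (tnth e i) (tnth e j).

Definition bfrank (B : bilform) : nat := \rank (gram (vbasis {:V}) B).

Definition is_code (d : nat) (C : {set bilform}) : Prop :=
  [/\ C \subset sym_bilforms, (1 < #|C|)%N &
    forall A B, A \in C -> B \in C -> A != B -> (d <= bfrank (A - B)%R)%N].

Definition max_code_size (n d : nat) : nat :=
  if odd (n - d) then (#|F| ^ ((n + 1) * (n - d + 1))./2)%N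
  else (#|F| ^ (n * (n - d + 2))./2)%N.

Definition is_maximum_additive_code (d : nat) (C : {set bilform}) : Prop :=
  [/\ is_code d C, zmod_closed C & #|C| = max_code_size (\dim {:V}) d].

Definition is_maximum_linear_code (d : nat) (C : {set bilform}) : Prop :=
  is_maximum_additive_code d C /\ submod_closed C.

Lemma bilform_ofE (f : V -> V -> F) :
    (forall y, scalar (f^~ y)) -> (forall x, scalar (f x)) ->
  forall x y, bfeval (bilform_of f) x y = f x y.
Proof.
move=> fl fr x y; rewrite /bfeval /bilform_of.
have r2 u v : linfun (f u : V -> F^o) v = f u v.
  pose h := GRing.isLinear.Build F V F^o *:%R (f u : V -> F^o) (fr u).
  pose g : {linear V -> F^o} := HB.pack (f u : V -> F^o) h.
  by rewrite (lfunE g).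
have l1 : linear (fun u : V => linfun (f u : V -> F^o)).
  move=> a u v; apply/lfunP=> w.
  by rewrite add_lfunE scale_lfunE !r2 fl.
pose h := GRing.isLinear.Build F V _ *:%R _ l1.
pose g : {linear V -> 'Hom(V, F^o)} :=
  HB.pack (fun u : V => linfun (f u : V -> F^o)) h.
by rewrite (lfunE g) r2.
Qed.

Lemma bfevalB (A B : bilform) x y :
  bfeval (A - B) x y = bfeval A x y - bfeval B x y.
Proof. by rewrite /bfeval add_lfunE opp_lfunE add_lfunE opp_lfunE. Qed.

Lemma bfevalZ a (A : bilform) x y : bfeval (a *: A) x y = a * bfeval A x y.
Proof. by rewrite /bfeval !scale_lfunE. Qed.

Lemma bilformP (A B : bilform) :
  (forall x y, bfeval A x y = bfeval B x y) <-> A = B.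
Proof.
by split=> [eqAB | -> //]; apply/lfunP=> x; apply/lfunP=> y; apply: eqAB.
Qed.

Lemma bfrank_basis (m : nat) (e : m.-tuple V) (B : bilform) :
  basis_of {:V} e -> \rank (gram e B) = bfrank B.
Proof.
rewrite /bfrank; move: (vbasisP {:V}); move: (vbasis {:V}) => b bb be.
have em : m = \dim {:V} by rewrite -(size_basis be).
case: _ / em b bb => b bb.
have rank_le (e1 e2 : m.-tuple V) : basis_of {:V} e2 ->
    (\rank (gram e1 B) <= \rank (gram e2 B))%N.
  move=> be2; pose P := \matrix_(i < m, j < m) coord e2 j (tnth e1 i).
  have -> : gram e1 B = P *m gram e2 B *m P^T.
    apply/matrixP=> i j; rewrite !mxE.
    have ex k : tnth e1 k = \sum_l P k l *: tnth e2 l.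
      rewrite {1}(coord_basis be2 (memvf (tnth e1 k))).
      by apply: eq_bigr => l _; rewrite mxE [tnth e2 l](tnth_nth 0).
    rewrite /bfeval (ex i) (ex j) linear_sum; apply: eq_bigr => l _.
    rewrite linearZ /= mulrC !mxE; congr (_ * _).
    rewrite linear_sum sum_lfunE; apply: eq_bigr => k _.
    by rewrite linearZ scale_lfunE !mxE.
  by rewrite (leq_trans (mxrankM_maxl _ _)) // mxrankM_maxr.
by apply/eqP; rewrite eqn_leq !rank_le.
Qed.

End BilinearForms.

Section Trace.

Variables (F : finFieldType) (L : fieldExtType F).

(* The Galois trace takes its values in the line [1%VS] of [L]; [coord [tuple 1]]
   reads them back in [F], see [alg_Tr]. *)
Definition Tr (x : L) : F :=
  coord [tuple (1 : L)] ord0 (galTrace 1 {:finvect_type L} x).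

Lemma alg_Tr (x : L) : (Tr x)%:A = galTrace 1 {:finvect_type L} x :> L.
Proof.
have gal : galois 1 {:finvect_type L}.
  exact: (finField_galois (sub1v _)).
have tr1 : (galTrace 1 {:finvect_type L} x : L) \in <<[tuple (1%R : L)]>>%VS.
  rewrite span_seq1; exact: (mem_galTrace gal (memvf _)).
by rewrite [RHS](coord_span tr1) big_ord1.
Qed.

Lemma Tr_linear : scalar Tr.
Proof.
move=> a x y; apply: (fmorph_inj (in_alg L)) => /=; rewrite scalerDl -scalerA.
rewrite !alg_Tr /galTrace scaler_sumr -big_split /=.
by apply: eq_bigr => g _; rewrite linearP.
Qed.

End Trace.

Section TheCode.

Variables (F : finFieldType) (L : fieldExtType F).

Local Notation q := #|F|.

Definition Tform_fun (k s : nat) (eta b0 b1 b2 : L) (x y : L) : F :=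
  Tr (b0 * x ^+ (q ^ k) * y
      + b1 * (x ^+ (q ^ (s * (k - 1))) * y + y ^+ (q ^ (s * (k - 1))) * x)
      + eta * b2 * (x ^+ (q ^ (s * (k - 2))) * y + y ^+ (q ^ (s * (k - 2))) * x)).

(* [K] is the subfield of [L] with q^k elements. *)
Definition Tcode (K : {subfield L}) (k s : nat) (eta : L) : {set bilform L} :=
  [set B | [exists b0 : finvect_type L, exists b1 : finvect_type L,
    exists b2 : finvect_type L,
    [&& (b0 : L) \in K, (b2 : L) \in K &
        B == bilform_of (Tform_fun k s eta b0 b1 b2)]]].

Lemma expq_linear (i : nat) (a : F) (x y : L) :
  (a *: x + y) ^+ (q ^ i) = a *: x ^+ (q ^ i) + y ^+ (q ^ i).
Proof.
have [p pr_p pF] := finPcharP F.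
have pL : p \in [pchar L] by rewrite (fmorph_pchar (in_alg L)).
have nq : [pchar L].-nat (q ^ i)%N.
  rewrite pnatX; apply/orP; left; rewrite (eq_pnat _ (pcharf_eq pL)) -cardsT.
  exact: abelem_pgroup (fin_ring_pchar_abelem pF).
rewrite exprDn_pchar // exprZn; congr (_ *: _ + _).
by elim: i {nq} => // i IHi; rewrite expnS exprM expf_card.
Qed.

Let lin_l (A : comAlgType F) (a : F) (b0 b1 c p p' r r' t t' w w' y z v : A) :
  b0 * (a *: p + p') * v + b1 * ((a *: r + r') * v + y * (a *: w + w'))
    + c * ((a *: t + t') * v + z * (a *: w + w'))
  = a *: (b0 * p * v + b1 * (r * v + y * w) + c * (t * v + z * w))
    + (b0 * p' * v + b1 * (r' * v + y * w') + c * (t' * v + z * w')).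
Proof.
have [a' Z] : exists a', forall x : A, a *: x = a' * x.
  by exists a%:A => x; rewrite mulr_algl.
by rewrite !Z; ring.
Qed.

Let lin_r (A : comAlgType F) (a : F) (b0 b1 c p r t w w' y y' z z' u : A) :
  b0 * p * (a *: w + w') + b1 * (r * (a *: w + w') + (a *: y + y') * u)
    + c * (t * (a *: w + w') + (a *: z + z') * u)
  = a *: (b0 * p * w + b1 * (r * w + y * u) + c * (t * w + z * u))
    + (b0 * p * w' + b1 * (r * w' + y' * u) + c * (t * w' + z' * u)).
Proof.
have [a' Z] : exists a', forall x : A, a *: x = a' * x.
  by exists a%:A => x; rewrite mulr_algl.
by rewrite !Z; ring.
Qed.

Lemma Tform_funE (k s : nat) (eta b0 b1 b2 x y : L) :
  bfeval (bilform_of (Tform_fun k s eta b0 b1 b2)) x y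
    = Tform_fun k s eta b0 b1 b2 x y.
Proof.
apply: bilform_ofE => [v | u] a w1 w2;
  rewrite /Tform_fun -Tr_linear !expq_linear; congr Tr.
- exact: lin_l.
- exact: lin_r.
Qed.

End TheCode.

(* Main.v *)
Require Import Defs.
From HB Require Import structures.
From mathcomp Require Import all_boot all_order all_fingroup all_algebra all_solvable all_field.
From mathcomp Require Import ring zify.

Set Implicit Arguments.
Unset Strict Implicit.
Unset Printing Implicit Defensive.

Import GRing.Theory.
Local Open Scope ring_scope.

(** Let S be x |-> x^(q^s) and T = S^k be x |-> x^(q^k). A form of the code is
    Tr (y * f x) with f x, as a function of z = S^(k-2) x, equal to
      P z = a z + b Sz + c S^2 z + ST(b) S^3 z + S^2 T(a) S^4 z,
    where Tc = c and a = eta b2 is zero or a nonsquare; its rank is at least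
    n - 2 if and only if P does not have three independent kernel vectors.
    Scaling one kernel vector to 1, the symmetry of the coefficients forces
    d = a + Sa + b to be T-fixed, and P = (S - 1) R (S - 1) with
      R z = a z + d Sz + ST(a) S^2 z.
    Two further kernel vectors of P give a nonzero kernel vector of R; scaling
    it to 1, the same argument forces a to be T-fixed, hence a square in L.
    Scalings multiply a by a square, so a is a square to begin with.
    If a = 0, the three-term P is treated in the same way, one step shorter. *)

(** * Kernels of skew polynomials with self-adjoint coefficients *)

Section SkewKernels.

Variables (L : fieldType) (S T : {rmorphism L -> L}).

Definition is_square (x : L) : Prop := exists z, x = z ^+ 2.

(** Linear independence over the fixed field of [S], over which every polynomial in [S] is
    linear. *)
Definition fix_free3 (x0 x1 x2 : L) : Prop :=
  forall a0 a1 a2, S a0 = a0 -> S a1 = a1 -> S a2 = a2 ->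
    a0 * x0 + a1 * x1 + a2 * x2 = 0 -> [/\ a0 = 0, a1 = 0 & a2 = 0].

(** For the Frobenius powers, [fixST] holds because the fixed field of [S] is [F], [squareMS] and
    [squareMT] because [1 + q^i] is even, and [square_fixT] because [L] is quadratic over the fixed
    field of [T]. *)
Hypothesis two_neq0 : 2%:R != 0 :> L.
Hypothesis STC : forall x, S (T x) = T (S x).
Hypothesis TK : forall x, T (T x) = x.
Hypothesis fixST : forall x, S x = x -> T x = x.
Hypothesis squareMS : forall x, is_square (x * S x).
Hypothesis squareMT : forall x, is_square (x * T x).
Hypothesis square_fixT : forall x, T x = x -> is_square x.

(** Certificate for [ring]: the goal is the multiple by [k] of a known equation. *)
Lemma eq_lincomb (k l r x y : L) : l = r -> x - y = k * (l - r) -> x = y.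
Proof. by move=> ->; rewrite subrr mulr0 => /eqP; rewrite subr_eq0 => /eqP. Qed.

Arguments eq_lincomb k {l r x y} _ _.

Lemma square_trans y x z : y != 0 ->
  is_square (x * y) -> is_square (y * z) -> is_square (x * z).
Proof.
move=> y0 [u xy] [v yz]; exists (u * v / y).
by rewrite exprMn exprMn -xy -yz; field.
Qed.

Lemma square_cancel x y : y != 0 -> is_square y -> is_square (x * y) ->
  is_square x.
Proof.
move=> y0 [u uE] [v vE]; exists (v / u).
rewrite exprMn exprVn -uE -vE; field => //.
Qed.

Lemma squareMST x : is_square (x * S (T x)).
Proof.
have [->|x0] := eqVneq x 0; first by exists 0; rewrite mul0r expr0n.
by apply: (@square_trans (T x)) => //; rewrite fmorph_eq0.
Qed.

Lemma squareMSST x : is_square (x * S (S (T x))).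
Proof.
have [->|x0] := eqVneq x 0; first by exists 0; rewrite mul0r expr0n.
apply: (@square_trans (S (T x))) => //; first by rewrite !fmorph_eq0.
exact: squareMST.
Qed.

(* [d - T d] is fixed by [S], hence by [T], while [T] changes its sign. *)
Lemma fixT_of_addST d : T (d + S (T d)) = d + S (T d) -> T d = d.
Proof.
rewrite rmorphD /= -STC TK => e.
have Se : S (d - T d) = d - T d.
  by rewrite rmorphB /=; apply: (eq_lincomb 1 e); ring.
have := fixST Se; rewrite rmorphB TK => e2.
have /eqP : 2%:R * (d - T d) = 0 by apply: (eq_lincomb (-1) e2); ring.
by rewrite mulf_eq0 (negPf two_neq0) subr_eq0 => /eqP.
Qed.

(** Put [d = a * w * S (T w)]. Multiplying the kernel equation by [S (T w)] turns its outer terms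
    into [d] and [S (T d)], and its middle term into a [T]-fixed element, since [T] exchanges [S w]
    and [S (T w)]. *)
Lemma kernel2_fixT a c w : T c = c ->
    a * w + c * S w + S (T a) * S (S w) = 0 ->
  T (a * w * S (T w)) = a * w * S (T w).
Proof.
move=> Tc e; apply: fixT_of_addST.
have -> : a * w * S (T w) + S (T (a * w * S (T w))) = - (c * S w * S (T w)).
  by rewrite !rmorphM /= -!STC TK; apply: (eq_lincomb (S (T w)) e); ring.
by rewrite rmorphN !rmorphM /= Tc -!STC TK; ring.
Qed.

Lemma kernel2_square a c w : w != 0 -> T c = c ->
  a * w + c * S w + S (T a) * S (S w) = 0 -> is_square a.
Proof.
move=> w0 Tc /(kernel2_fixT Tc)/square_fixT; rewrite -mulrA.
apply: square_cancel; last exact: squareMST.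
by rewrite mulf_neq0 // !fmorph_eq0.
Qed.

Lemma fix_free3_neq0 x0 x1 x2 : fix_free3 x0 x1 x2 -> x0 != 0.
Proof.
move=> fr; apply/eqP=> x00; have [] := fr 1 0 0; rewrite ?rmorph1 ?rmorph0 //.
  by rewrite x00; ring.
by move/eqP; rewrite oner_eq0.
Qed.

Lemma fix_free3_scale x0 x1 x2 :
  fix_free3 x0 x1 x2 -> fix_free3 1 (x1 / x0) (x2 / x0).
Proof.
move=> fr a0 a1 a2 f0 f1 f2 e; have x00 := fix_free3_neq0 fr.
apply: fr => //.
have -> : a0 * x0 + a1 * x1 + a2 * x2
          = x0 * (a0 * 1 + a1 * (x1 / x0) + a2 * (x2 / x0)) by field.
by rewrite e mulr0.
Qed.

(** The kernel of [S - 1] is the fixed field, the line spanned by [1]; so [S - 1] keeps [y1] and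
    [y2] independent. *)
Lemma fix_free3_diff y1 y2 : fix_free3 1 y1 y2 ->
  forall a1 a2, S a1 = a1 -> S a2 = a2 -> (a1 != 0) || (a2 != 0) ->
    a1 * (S y1 - y1) + a2 * (S y2 - y2) != 0.
Proof.
move=> fr a1 a2 f1 f2; apply: contraTN => /eqP e.
have [] := fr (- (a1 * y1 + a2 * y2)) a1 a2 => //; last 2 first.
- by ring.
- by move=> _ -> ->; rewrite eqxx.
rewrite rmorphN rmorphD !rmorphM /= f1 f2.
by apply: (eq_lincomb (-1) e); ring.
Qed.

(** After scaling [x0] to [1], the operator is [(S - 1) g (S - 1)] with [g] nonzero and [T]-fixed.
    Its kernel has dimension at most two, because [g * (S y - y)] must lie in the fixed field. *)
Lemma kernel2_not_free3 b c x0 x1 x2 : T c = c -> b != 0 ->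
    (forall x, x \in [:: x0; x1; x2] ->
       b * x + c * S x + S (T b) * S (S x) = 0) ->
  ~ fix_free3 x0 x1 x2.
Proof.
move=> Tc b0 ker fr; have x00 := fix_free3_neq0 fr.
have e0 := ker x0; rewrite mem_head in e0; move: {e0}(e0 isT) => e0.
pose g := b * x0 * S (T x0).
have g0 : g != 0 by rewrite !mulf_neq0 // !fmorph_eq0.
have Tg : T g = g := kernel2_fixT Tc e0.
have fixQ x : x \in [:: x0; x1; x2] ->
    S (g * (S (x / x0) - x / x0)) = g * (S (x / x0) - x / x0).
  rewrite -{1}[x](divfK x00) mulrC => /ker; move: (x / x0) => y.
  rewrite (rmorphM S x0) (rmorphM S (S x0)) => e; rewrite rmorphM rmorphB /=.
  have Sg : S g = S (T b) * S (T x0) * S (S x0).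
    by rewrite -{1}Tg /g !rmorphM /= -!STC TK.
  have cE : c * S x0 * S (T x0) = - (g + S g).
    by rewrite Sg /g; apply: (eq_lincomb (S (T x0)) e0); ring.
  have eg : g * y + c * S x0 * S (T x0) * S y + S g * S (S y) = 0.
    by rewrite Sg /g; apply: (eq_lincomb (S (T x0)) e); ring.
  by rewrite cE in eg; apply: (eq_lincomb 1 eg); ring.
have z_neq0 := fix_free3_diff (fix_free3_scale fr).
pose y1 := x1 / x0; pose y2 := x2 / x0.
have f1 := fixQ x1; have f2 := fixQ x2; rewrite !inE !eqxx !orbT in f1 f2.
(* The two values of [g * (S y - y)] are themselves fixed scalars, so they serve as coefficients of
   a trivial relation. *)
suff: g * (S y2 - y2) * (S y1 - y1) + - (g * (S y1 - y1)) * (S y2 - y2) != 0.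
  by apply/negP; rewrite negbK; apply/eqP; ring.
apply: (z_neq0); rewrite ?rmorphN ?f1 ?f2 // mulf_neq0 //.
have := z_neq0 0 1; rewrite rmorph0 rmorph1 mul0r add0r mul1r; apply=> //.
by rewrite oner_eq0 orbT.
Qed.

Lemma kernel4_square a b c x0 x1 x2 : T c = c ->
    (forall x, x \in [:: x0; x1; x2] ->
       a * x + b * S x + c * S (S x) + S (T b) * S (S (S x))
         + S (S (T a)) * S (S (S (S x))) = 0) ->
  fix_free3 x0 x1 x2 -> is_square a.
Proof.
move=> Tc ker fr; have x00 := fix_free3_neq0 fr.
have m0 : x0 \in [:: x0; x1; x2] by rewrite !inE eqxx.
have m1 : x1 \in [:: x0; x1; x2] by rewrite !inE eqxx orbT.
have m2 : x2 \in [:: x0; x1; x2] by rewrite !inE eqxx !orbT.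
(* Substituting [x = x0 * y] and multiplying by [l] preserves the coefficient pattern
   [a, b, c, ST(b), S^2 T(a)] and the condition [T c = c]. *)
pose l := S (S (T x0)).
pose a' := a * x0 * l; pose b' := b * S x0 * l; pose c' := c * S (S x0) * l.
suff: is_square a'.
  rewrite /a' -mulrA; apply: square_cancel; last exact: squareMSST.
  by rewrite mulf_neq0 // !fmorph_eq0.
have Tc' : T c' = c' by rewrite /c' /l !rmorphM /= Tc -!STC TK; ring.
have ker' x : x \in [:: x0; x1; x2] -> let y := x / x0 in
    a' * y + b' * S y + c' * S (S y) + S (T b') * S (S (S y))
      + S (S (T a')) * S (S (S (S y))) = 0.
  rewrite -{1}[x](divfK x00) mulrC => /ker; move: (x / x0) => y /=.
  rewrite /a' /b' /c' /l !rmorphM /= -!STC !TK => e.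
  by apply: (eq_lincomb (S (S (T x0))) e); ring.
have := ker' _ m0; rewrite /= divff // !rmorph1 !mulr1 => e1.
clearbody a' b' c'; have [d dE] : exists d, d = a' + S a' + b' by eexists.
have Td : T d = d.
  apply: fixT_of_addST.
  have -> : d + S (T d) = S (a' + T a') - c'.
    rewrite dE !rmorphD /= -!STC; apply: (eq_lincomb 1 e1); ring.
  by rewrite rmorphB /= Tc' -STC [T (_ + _)]rmorphD TK [T a' + _]addrC.
pose R z := a' * z + d * S z + S (T a') * S (S z).
pose Z x := S (x / x0) - x / x0.
have fixR x : x \in [:: x0; x1; x2] -> S (R (Z x)) = R (Z x).
  (* Eliminating [c'] by means of [P 1 = 0] turns the kernel equation at [y] into
     [(S - 1) (R (S y - y)) = 0]. *)
  move/ker'; rewrite /R /Z /=; move: (x / x0) => y e.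
  have Sd : S d = S (T a') + S (S (T a')) + S (T b').
    by rewrite -{1}Td dE !rmorphD /= -!STC.
  have c'E : c' = - (a' + b' + S (T b') + S (S (T a'))).
    by apply: (eq_lincomb 1 e1); ring.
  rewrite !(rmorphD, rmorphM, rmorphB) /= Sd dE.
  by rewrite c'E in e; apply: (eq_lincomb 1 e); ring.
have free := fix_free3_diff (fix_free3_scale fr).
have RD u v z t : S u = u -> S v = v -> R (u * z + v * t) = u * R z + v * R t.
  by move=> Su Sv; rewrite /R !(rmorphD, rmorphM) /= !Su !Sv; ring.
have sqR z : z != 0 -> R z = 0 -> is_square a'.
  by move=> z0; apply: kernel2_square Td.
(* [R] takes values in the fixed field at [Z x1] and [Z x2], so some nontrivial combination of these
   is in its kernel: [Z x1] itself, or the one that cancels the two values. *)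
have [r1|r1] := eqVneq (R (Z x1)) 0.
  apply: (sqR (Z x1)) => //; have := free 1 0.
  by rewrite rmorph0 rmorph1 mul0r addr0 mul1r; apply; rewrite ?oner_eq0.
apply: (sqR (R (Z x2) * Z x1 + (- R (Z x1)) * Z x2)).
  by apply: free; rewrite ?rmorphN ?fixR // oppr_eq0 r1 orbT.
by rewrite RD ?rmorphN ?fixR //; ring.
Qed.

(** For [a = 0] the polynomial is the three-term one evaluated at [S x], and [S] preserves
    independence; if also [b = 0], only [c * S (S x)] remains. *)
Lemma kernel4_not_free3 a b c x0 x1 x2 : T c = c -> a = 0 \/ ~ is_square a ->
    (forall x, x \in [:: x0; x1; x2] ->
       a * x + b * S x + c * S (S x) + S (T b) * S (S (S x))
         + S (S (T a)) * S (S (S (S x))) = 0) ->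
  fix_free3 x0 x1 x2 -> [/\ a = 0, b = 0 & c = 0].
Proof.
move=> Tc aP ker fr.
case: aP => [a0|]; last by case; apply: kernel4_square ker fr.
have ker2 x : x \in [:: x0; x1; x2] ->
    b * S x + c * S (S x) + S (T b) * S (S (S x)) = 0.
  by move/ker; rewrite a0 !rmorph0 !mul0r add0r addr0.
have [b0|b0] := eqVneq b 0; last first.
  case: (@kernel2_not_free3 b c (S x0) (S x1) (S x2) Tc b0 _ _).
    by move=> _ /(@mapP _ _ S [:: x0; x1; x2])[x /ker2 e ->].
  move=> a0' a1 a2 f0 f1 f2; rewrite -{1}f0 -{1}f1 -{1}f2 -!rmorphM -!rmorphD.
  by move/eqP; rewrite fmorph_eq0 => /eqP; apply: fr.
split=> //; have := ker2 x0 (mem_head _ _).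
rewrite b0 !rmorph0 !mul0r add0r addr0 => /eqP; rewrite mulf_eq0 !fmorph_eq0.
by rewrite (negPf (fix_free3_neq0 fr)) orbF => /eqP.
Qed.

End SkewKernels.

(** * Frobenius powers and the trace *)

Section Frobenius.

Variables (F : finFieldType) (L : fieldExtType F).

Local Notation q := #|F|.
Local Notation n := (\dim {:L}).

Definition frob (i : nat) (x : L) : L := x ^+ (q ^ i).

Fact frob_zmod_morphism i : zmod_morphism (frob i).
Proof.
move=> x y; rewrite -[in LHS](addrC (- y)) -scaleN1r /frob expq_linear.
by rewrite scaleN1r addrC.
Qed.

Fact frob_monoid_morphism i : monoid_morphism (frob i).
Proof. by split=> [|x y]; rewrite /frob ?expr1n ?exprMn. Qed.

HB.instance Definition _ i :=
  GRing.isZmodMorphism.Build L L (frob i) (frob_zmod_morphism i).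
HB.instance Definition _ i :=
  GRing.isMonoidMorphism.Build L L (frob i) (frob_monoid_morphism i).

Lemma frob_add i j x : frob (i + j) x = frob i (frob j x).
Proof. by rewrite /frob -exprM -expnD addnC. Qed.

Lemma frobC i j x : frob i (frob j x) = frob j (frob i x).
Proof. by rewrite -!frob_add addnC. Qed.

Lemma frob0 x : frob 0 x = x. Proof. by rewrite /frob expr1. Qed.

Lemma frob_alg i (c : F) : frob i c%:A = c%:A.
Proof.
have := expq_linear (L := L) i c 1 0.
by rewrite addr0 expr1n -[0 ^+ _]/(frob i 0) rmorph0 addr0.
Qed.

Lemma memv_frob (K : {subfield L}) x : (x \in K) = (frob (\dim K) x == x).
Proof. exact: Fermat's_little_theorem. Qed.

Lemma frob_dim_mul j x : frob (n * j) x = x.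
Proof.
elim: j => [|j IHj]; first by rewrite muln0 frob0.
by rewrite mulnS frob_add IHj; apply/eqP; rewrite -memv_frob memvf.
Qed.

Lemma frob_modn i j x : i = j %[mod n] -> frob i x = frob j x.
Proof.
move=> eqij; rewrite (divn_eq i n) (divn_eq j n) eqij ![(_ * n)%N]mulnC.
by rewrite !frob_add !frob_dim_mul.
Qed.

(** By Bezout some multiple of [s] is [1] modulo [n], so [x] is fixed by the [q]-Frobenius
    itself. *)
Lemma frob_fixed s x : coprime s n -> frob s x = x -> exists c : F, x = c%:A.
Proof.
have n_gt0 : (0 < n)%N by rewrite adim_gt0.
(* The Bezout lemma requires [s > 0]; for [s = 0] coprimality forces [n = 1]. *)
have [->|s_gt0] := posnP s.
  rewrite /coprime gcd0n => /eqP n1 _; apply/vlineP.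
  by rewrite (memv_frob 1%AS) dimv1 -[X in frob X]n1 -memv_frob memvf.
move=> + sx; case: (egcdnP n s_gt0) => km kn e _ /eqP co.
apply/vlineP; rewrite (memv_frob 1%AS) dimv1.
have fixm m : frob (m * s) x = x.
  by elim: m => [|m IHm]; rewrite ?mul0n ?frob0 // mulSn frob_add IHm.
rewrite -{2}(fixm km) e co; apply/eqP/frob_modn.
by rewrite modnMDl.
Qed.

Lemma TrD (x y : L) : Tr (x + y) = Tr x + Tr y.
Proof. by have := Tr_linear 1 x y; rewrite scale1r mul1r. Qed.

(** Frobenius commutes with every Galois automorphism and fixes the trace, which lies in [F]. *)
Lemma Tr_frob i (x : L) : Tr (frob i x) = Tr x.
Proof.
apply: (fmorph_inj (in_alg L)) => /=; rewrite -[RHS](frob_alg i) !alg_Tr.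
rewrite /galTrace -[RHS]/(frob i _) (rmorph_sum (frob i)).
by apply: eq_bigr => g _; rewrite /frob rmorphXn.
Qed.

(** By independence of the automorphisms the trace is nonzero at some [z]; for [x != 0] take
    [y = z / x]. *)
Lemma Tr_nondegenerate (x : L) : (forall y, Tr (y * x) = 0) -> x = 0.
Proof.
move=> tr0; apply/eqP/negPn/negP=> x0.
have [||z _ /negP[]] := @gal_independent_contra F (finvect_type L)
    {:finvect_type L}%AS (mem 'Gal({:finvect_type L} / 1)%g) (fun _ => 1) 1%g.
- exact: group1.
- exact: oner_neq0.
apply/eqP; transitivity (galTrace 1 {:finvect_type L} (z : L)).
  by rewrite /galTrace; apply: eq_bigr => g _; rewrite mul1r.
by rewrite -(alg_Tr (z : L)) -[z](divfK x0) tr0 scale0r.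
Qed.

End Frobenius.

(** * Squares in odd characteristic *)

Section OddCharacteristic.

Variables (F : finFieldType) (L : fieldExtType F).
Hypothesis q_odd : odd #|F|.

Local Notation q := #|F|.
Local Notation n := (\dim {:L}).

Lemma odd_card_two_neq0 : 2%:R != 0 :> L.
Proof.
have [p pr_p pF] := finPcharP F.
have pL : p \in [pchar L] by rewrite (fmorph_pchar (in_alg L)).
rewrite -(dvdn_pcharf pL); apply/negP => /(@dvdn_leq _ 2 isT) p_le2.
have p2 : p = 2%N by apply/eqP; rewrite eqn_leq p_le2 prime_gt1.
have : p.-nat q.
  by rewrite -cardsT; exact: abelem_pgroup (fin_ring_pchar_abelem pF).
rewrite p2 => /pnatP; have q1 : (1 < q)%N := finNzRing_gt1 F.
move/(_ (ltnW q1) (pdiv q) (pdiv_prime q1) (pdiv_dvd q)).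
rewrite inE => /eqP d2.
by have := pdiv_dvd q; rewrite d2 dvdn2 q_odd.
Qed.

Lemma square_mul_frob i (x : L) : is_square (x * frob i x).
Proof.
exists (x ^+ (q ^ i).+1./2); rewrite -exprM /frob -exprS; congr (_ ^+ _).
rewrite muln2 -{1}[(q ^ i).+1]odd_double_half /= oddX q_odd orbT; lia.
Qed.

(** Let [Q = q^k] and write [x = g^i] with [g] a generator of the unit group, of order [Q^2 - 1].
    From [x^(Q - 1) = 1] it follows that [Q + 1] divides [i], and [Q + 1] is even. *)
Lemma square_of_frob_half k (x : L) : n = (2 * k)%N -> frob k x = x ->
  is_square x.
Proof.
move=> nE fx; have [->|x0] := eqVneq x 0; first by exists 0; rewrite expr0n.
have /cyclicP[g gE] := field_unit_group_cyclic [set: {unit finvect_type L}]%G.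
have x0' : (x : finvect_type L) != 0 by [].
pose u := finField_unit x0'.
have : u \in <[g]>%g by rewrite -gE inE.
case/cycleP=> i uE.
have xE : x = (val g : L) ^+ i.
  by rewrite -[x]/(val u) uE FinRing.val_unitX.
have og : #[g]%g = (q ^ n).-1.
  rewrite -[#[g]%g]/(#|<[g]>%g|) -gE card_finField_unit; congr _.-1.
  rewrite -(card_vspace {:finvect_type L}).
  by apply: eq_card => v; rewrite [RHS](@memvf _ (finvect_type L)).
have q1 : (1 < q)%N := finNzRing_gt1 F.
have qk0 : (0 < q ^ k)%N by rewrite expn_gt0 ltnW.
have : (u ^+ (q ^ k).-1 == 1)%g.
  apply/eqP/val_inj; rewrite FinRing.val_unitX /=.
  apply: (mulIf x0'); rewrite mul1r -exprSr prednK //.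
rewrite uE -expgM -order_dvdn og nE mulnC expnM.
have k_gt0 : (0 < k)%N by have := adim_gt0 {:L}%AS; rewrite /= nE; lia.
have Q1 : (1 < q ^ k)%N by rewrite -(expn0 q) ltn_exp2l.
have oQ : odd (q ^ k) by rewrite oddX q_odd orbT.
move: (q ^ k)%N Q1 oQ => Q Q1 oQ.
have -> : (Q ^ 2).-1 = (Q.+1 * Q.-1)%N by rewrite -mulnn; nia.
rewrite dvdn_pmul2r ?ltn_predRL // => Qi; exists ((val g : L) ^+ i./2).
have iE : ~~ odd i by rewrite -dvdn2 (dvdn_trans _ Qi) // dvdn2 /= oQ.
by rewrite -exprM muln2 even_halfK // xE.
Qed.
End OddCharacteristic.

(** * Rank and radical of a bilinear form *)

Section Radical.

Variables (F : finFieldType) (V : vectType F).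

Lemma bfevalD (A B : bilform V) x y :
  bfeval (A + B) x y = bfeval A x y + bfeval B x y.
Proof. by rewrite /bfeval !add_lfunE. Qed.

(** The rows of a basis of the left kernel of the Gram matrix are coordinates of independent vectors
    in the radical. *)
Lemma bfrank_lker (B : bilform V) :
  (\dim {:V} <= bfrank B + \dim (lker (B : 'Hom(V, 'Hom(V, F^o)))))%N.
Proof.
rewrite /bfrank; have be := vbasisP {:V}; move: (vbasis {:V}) be => e be.
set G := gram e B; rewrite -leq_subLR -mxrank_ker.
pose R := row_base (kermx G).
pose x i := \sum_j R i j *: e`_j.
have x_lker i : x i \in lker (B : 'Hom(V, 'Hom(V, F^o))).
  have RG : R *m G = 0 by apply/sub_kermxP; rewrite eq_row_base.
  rewrite memv_ker; apply/eqP/lfunP => y; rewrite zero_lfunE.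
  rewrite (coord_basis be (memvf y)) linear_sum big1 // => l _.
  rewrite linearZ /= /x linear_sum sum_lfunE.
  have /matrixP/(_ i l) := RG; rewrite !mxE => RG_il.
  rewrite [X in _ *: X](_ : _ = 0) ?scaler0 // -[RHS]RG_il.
  apply: eq_bigr => j _; rewrite linearZ scale_lfunE /G [gram e B _ _]mxE.
  by rewrite /bfeval !(tnth_nth 0).
pose X := [tuple x i | i < \rank (kermx G)].
have freeX : free X.
  apply/freeP => c; under eq_bigr do rewrite -tnth_nth tnth_mktuple.
  move=> sum0; pose v := \row_i c i.
  have vR0 : v *m R = 0.
    apply/rowP => j; rewrite [RHS]mxE.
    move/basis_free/freeP: be => /(_ (fun j => (v *m R) 0 j)) -> //.
    rewrite -[RHS]sum0; under [RHS]eq_bigr do rewrite /x scaler_sumr.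
    rewrite exchange_big; apply: eq_bigr => l _ /=.
    rewrite mxE scaler_suml; apply: eq_bigr => i _.
    by rewrite scalerA mxE.
  have v0 : v = 0.
    by apply: (row_free_inj (row_base_free (kermx G))); rewrite mul0mx.
  by move=> i; have /rowP/(_ i) := v0; rewrite !mxE.
rewrite -[leqLHS](size_tuple X) -(eqP freeX); apply: dimvS.
by apply/span_subvP => _ /tnthP[i ->]; rewrite tnth_mktuple.
Qed.

End Radical.

(** * The forms of the code: rank, symmetry and number *)

Section TheForms.

Variables (F : finFieldType) (L : fieldExtType F) (K : {subfield L}).
Variables (k s : nat) (eta : L).

Local Notation q := #|F|.
Local Notation n := (\dim {:L}).

Hypothesis q_odd : odd q.
Hypothesis dimL : n = (2 * k)%N.
Hypothesis dimK : \dim K = k.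
Hypothesis k_ge2 : (2 <= k)%N.
Hypothesis s_coprime : coprime s (2 * k).
Hypothesis eta_nonsquare : ~ is_square eta.

Local Notation form b0 b1 b2 := (bilform_of (Tform_fun k s eta b0 b1 b2)).
Local Notation S := (frob (L := L) s).
Local Notation T := (frob (L := L) k).

Lemma frob_half x : x \in K -> T x = x.
Proof. by rewrite memv_frob dimK => /eqP. Qed.

Lemma frob_halfK : involutive T.
Proof.
by move=> x; rewrite -frob_add addnn -mul2n -dimL -[n]muln1 frob_dim_mul.
Qed.

(** Being coprime to [2 * k], [s] is odd, hence [s * k] is [k] modulo [2 * k]. *)
Lemma frob_half_mul x : frob (s * k) x = T x.
Proof.
have s_odd : odd s.
  have : coprime s 2 by apply: coprime_dvdr s_coprime; rewrite dvdn_mulr.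
  by rewrite coprimen2.
apply: frob_modn; rewrite dimL -[s]odd_double_half s_odd mulnDl mul1n.
by rewrite -mul2n mulnAC mulnC addnC modnMDl.
Qed.

(** The map representing the form through the trace pairing. Its terms in [k + 1] and [k + 2] are
    the trace adjoints of those in [k - 1] and [k - 2]. *)
Definition form_map (a b c x : L) : L :=
  c * T x + b * frob (s * (k - 1)) x + frob (s * (k + 1)) (b * x)
    + a * frob (s * (k - 2)) x + frob (s * (k + 2)) (a * x).

Lemma form_mapE b0 b1 b2 x y :
  bfeval (form b0 b1 b2) x y = Tr (y * form_map (eta * b2) b1 b0 x).
Proof.
(* Applying the power [s * (k + i)] under the trace brings the exponent on [y] to [s * (2 * k)],
   which is the identity. *)
have move_frob i b : (i <= k)%N ->
    Tr (b * frob (s * (k - i)) y * x) = Tr (y * frob (s * (k + i)) (b * x)).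
  move=> ik; rewrite -(Tr_frob (s * (k + i))) !rmorphM /= -frob_add.
  rewrite -mulnDr (_ : k + i + (k - i) = 2 * k)%N; last by lia.
  by rewrite [(s * (2 * k))%N]mulnC -dimL frob_dim_mul; congr Tr; ring.
rewrite Tform_funE /Tform_fun /form_map !mulrDr !TrD.
rewrite -!move_frob //; last by lia.
rewrite -!TrD; congr Tr; rewrite /frob; ring.
Qed.

Lemma form_mapS a b c x : let z := frob (s * (k - 2)) x in
  form_map a b c x = a * z + b * S z + c * S (S z) + S (T b) * S (S (S z))
    + S (S (T a)) * S (S (S (S z))).
Proof.
rewrite /= -!frob_add /form_map !rmorphM /=.
have -> : (s + s * (k - 2) = s * (k - 1))%N by nia.
have -> : (s + s * (k - 1) = s * k)%N by nia.
have -> : (s + s * k = s * (k + 1))%N by nia.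
have -> : (s + s * (k + 1) = s * (k + 2))%N by nia.
have addl (u : L) : frob (s + k) u = frob (s * (k + 1)) u.
  by rewrite (frob_add s k) -(frob_half_mul u) -frob_add mulnDr muln1 addnC.
rewrite addl (_ : frob (s + s + k) a = frob (s * (k + 2)) a); last first.
  by rewrite -addnA frob_add addl -frob_add; congr frob; nia.
rewrite frob_half_mul; ring.
Qed.

(** The fixed field of [S] is [F], and [frob i] is [F]-linear and injective. *)
Lemma free_fix_free3 i (x0 x1 x2 : L) : free [:: x0; x1; x2] ->
  fix_free3 S (frob i x0) (frob i x1) (frob i x2).
Proof.
have sn : coprime s n by rewrite dimL.
move=> fr a0 a1 a2 /(frob_fixed sn)[c0 ->] /(frob_fixed sn)[c1 ->].
move=> /(frob_fixed sn)[c2 ->]; rewrite -(frob_alg L i c0).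
rewrite -(frob_alg L i c1) -(frob_alg L i c2) -!rmorphM -!rmorphD => /eqP.
rewrite fmorph_eq0 !mulr_algl => /eqP e0; rewrite !frob_alg.
have /freeP : free (in_tuple [:: x0; x1; x2]) by [].
move/(_ (fun j => [:: c0; c1; c2]`_j)); rewrite !big_ord_recl big_ord0 /= addr0.
rewrite addrA => /(_ e0) c_eq0.
have := c_eq0 0; have := c_eq0 1; have := c_eq0 2%:R => /= -> -> ->.
by rewrite scale0r.
Qed.

(** Every element of [K] is a square in [L]. *)
Lemma eta_mul_square b : b \in K -> eta * b = 0 \/ ~ is_square (eta * b).
Proof.
move=> bK; have [->|b0] := eqVneq b 0; first by left; rewrite mulr0.
right=> sq; apply: eta_nonsquare; apply: square_cancel sq => //.
by apply: (square_of_frob_half q_odd dimL); rewrite frob_half.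
Qed.

Lemma form_rank (b0 b1 b2 : L) : b0 \in K -> b2 \in K ->
  [|| b0 != 0, b1 != 0 | b2 != 0] -> (n - 2 <= bfrank (form b0 b1 b2))%N.
Proof.
move=> b0K b2K; apply: contraTT; rewrite -ltnNge => rk.
have := bfrank_lker (form b0 b1 b2); set U := lker _ => dimU.
have dimU_gt2 : (2 < \dim U)%N by lia.
have [X [fr XU szX]] : exists X : seq L,
    [/\ free X, {subset X <= U} & (2 < size X)%N].
  exists (vbasis U); rewrite size_tuple; split=> //; last by move=> v /vbasis_mem.
  exact: basis_free (vbasisP U).
case: X fr XU szX => [|x0 [|x1 [|x2 r]]] // fr XU _.
have {}fr : free [:: x0; x1; x2] by apply: (catl_free (Y := r)).
have frz := free_fix_free3 (i := (s * (k - 2))%N) fr.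
have ker z : z \in map (frob (s * (k - 2))%N) [:: x0; x1; x2] ->
    let a := eta * b2 in
    a * z + b1 * S z + b0 * S (S z) + S (T b1) * S (S (S z))
      + S (S (T a)) * S (S (S (S z))) = 0.
  case/mapP=> x xX -> /=; rewrite -form_mapS; apply: Tr_nondegenerate => y.
  have /XU : x \in [:: x0, x1, x2 & r].
    by rewrite -[[:: _, _, _ & _]]/([:: x0; x1; x2] ++ r) mem_cat xX.
  by rewrite memv_ker -form_mapE /bfeval => /eqP ->; rewrite zero_lfunE.
have [||||||||] := kernel4_not_free3 (S := S) (T := T) _ _ _ _ _ _ _ _
  (eta_mul_square b2K) ker frz.
- exact: odd_card_two_neq0.
- by move=> x; exact: frobC.
- exact: frob_halfK.
- move=> x; have co : coprime s n by rewrite dimL.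
  by case/(frob_fixed co)=> c ->; exact: frob_alg.
- exact: square_mul_frob.
- exact: square_mul_frob.
- by move=> x; apply: square_of_frob_half.
- exact: frob_half.
(* From [eta * b2 = 0] one gets [b2 = 0], because [0] is a square and [eta] is not. *)
move=> /eqP; rewrite mulf_eq0 => /orP[/eqP eta0|/eqP-> -> ->].
  by case: eta_nonsquare; exists 0; rewrite eta0 expr0n.
by rewrite eqxx.
Qed.

Lemma form_linear c b0 b1 b2 d0 d1 d2 :
  form (c *: b0 + d0) (c *: b1 + d1) (c *: b2 + d2)
    = c *: form b0 b1 b2 + form d0 d1 d2.
Proof.
apply/bilformP => x y; rewrite bfevalD bfevalZ !Tform_funE /Tform_fun.
have [e Z] : exists e : L, forall z : L, c *: z = e * z.
  by exists c%:A => z; rewrite mulr_algl.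
by rewrite -Tr_linear !Z; congr Tr; ring.
Qed.

Lemma form0 : form 0 0 0 = 0.
Proof.
by have := form_linear (-1) 0 0 0 0 0 0; rewrite !scaler0 !addr0 scaleN1r addNr.
Qed.

Lemma form_sym b0 b1 b2 : b0 \in K -> form b0 b1 b2 \in sym_bilforms L.
Proof.
move=> b0K; rewrite inE; apply/forallP => x; apply/forallP => y; apply/eqP.
rewrite !Tform_funE /Tform_fun -!addrA !(TrD (_ * _ * _)); congr (_ + _).
  (* Applying [T] under the trace exchanges [x] and [y] in this term, since [b0] is [T]-fixed. *)
  rewrite -[in LHS](Tr_frob k) !rmorphM /= -[x ^+ _]/(T x) frob_halfK frob_half //.
  by congr Tr; rewrite /frob; ring.
by congr Tr; ring.
Qed.

Lemma TcodeP (B : bilform L) :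
  reflect (exists b : L * L * L,
             [/\ b.1.1 \in K, b.2 \in K & B = form b.1.1 b.1.2 b.2])
          (B \in Tcode K k s eta).
Proof.
rewrite inE; apply: (iffP existsP) => [[b0 /existsP[b1 /existsP[b2]]]|].
  by case/and3P=> b0K b2K /eqP->; exists (b0, b1, b2).
case=> [[[b0 b1] b2] [/= b0K b2K BE]]; exists b0; apply/existsP; exists b1.
by apply/existsP; exists b2; apply/and3P; split=> //; apply/eqP.
Qed.

Lemma Tcode_sub_sym : Tcode K k s eta \subset sym_bilforms L.
Proof. by apply/subsetP => _ /TcodeP[b [b0K _ ->]]; apply: form_sym. Qed.

Lemma Tcode_submod_closed : submod_closed (Tcode K k s eta).
Proof.
split=> [|c _ _ /TcodeP[b [b0K b2K ->]] /TcodeP[d [d0K d2K ->]]].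
  by apply/TcodeP; exists (0, 0, 0); rewrite /= form0 mem0v.
rewrite -form_linear; apply/TcodeP.
exists (c *: b.1.1 + d.1.1, c *: b.1.2 + d.1.2, c *: b.2 + d.2).
by split; rewrite // memvD ?memvZ.
Qed.

Lemma Tcode_rank (B : bilform L) : B \in Tcode K k s eta -> B != 0 ->
  (n - 2 <= bfrank B)%N.
Proof.
case/TcodeP=> b [b0K b2K ->] nz; apply: form_rank => //; apply: contraNT nz.
by rewrite !negb_or !negbK => /and3P[/eqP-> /eqP-> /eqP->]; rewrite form0.
Qed.

(** A nonzero difference of parameters would give the zero form rank at least [2 * k - 2 > 0]. *)
Lemma form_inj b d : b.1.1 \in K -> b.2 \in K -> d.1.1 \in K -> d.2 \in K ->
  form b.1.1 b.1.2 b.2 = form d.1.1 d.1.2 d.2 -> b = d.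
Proof.
case: b d => [[b0 b1] b2] [[d0 d1] d2] /= b0K b2K d0K d2K e.
have := @form_rank (b0 - d0) (b1 - d1) (b2 - d2).
have -> : form (b0 - d0) (b1 - d1) (b2 - d2) = 0.
  have := form_linear (-1) d0 d1 d2 b0 b1 b2.
  by rewrite !scaleN1r e addNr ![- _ + _]addrC.
have -> : bfrank (0 : bilform L) = 0%N.
  rewrite /bfrank (_ : gram _ _ = 0) ?mxrank0 //.
  by apply/matrixP => i j; rewrite !mxE /bfeval !zero_lfunE.
rewrite !memvB // => /(_ isT isT) rk.
have : ~~ [|| b0 - d0 != 0, b1 - d1 != 0 | b2 - d2 != 0].
  by apply/negP => /rk; rewrite dimL; lia.
rewrite !negb_or !negbK !subr_eq0 => /and3P[/eqP-> /eqP-> /eqP->].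
by [].
Qed.

Lemma card_Tcode : #|Tcode K k s eta| = (q ^ (2 * n))%N.
Proof.
pose E := finvect_type L; pose KE := [set x : E | (x : L) \in K].
pose D := setX (setX KE [set: E]) KE.
pose f (b : E * E * E) : bilform L := form b.1.1 b.1.2 b.2.
have -> : Tcode K k s eta = f @: D.
  apply/setP=> B; apply/TcodeP/imsetP => [[b [b0K b2K ->]]|[b]].
    by exists (b : E * E * E); rewrite // !inE b0K b2K.
  by rewrite !inE andbT => /andP[b0K b2K] ->; exists b.
rewrite card_in_imset => [|b d]; last first.
  rewrite !inE !andbT => /andP[b0K b2K] /andP[d0K d2K].
  exact: form_inj.
have cardKE : #|KE| = (q ^ k)%N.
  rewrite -dimK -(card_vspace (K : {vspace E})).
  by apply: eq_card => x; rewrite inE.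
have cardE : #|[set: E]| = (q ^ n)%N.
  rewrite -(card_vspace {:E}) cardsT.
  by apply: eq_card => x; rewrite [RHS](@memvf _ E).
by rewrite !cardsX cardKE cardE dimL -!expnD; congr (_ ^ _)%N; lia.
Qed.

End TheForms.

Theorem theorem1p2 (q k n s : nat) (F : finFieldType) (L : fieldExtType F)
    (K : {subfield L}) (eta : L)
    (hq : #|F| = q) (q_odd : odd q)
    (hk : k \in [:: 3; 4; 5]%N) (hn : n = (2 * k)%N)
    (dimL : \dim {:L} = n) (dimK : \dim K = k)
    (s_gt0 : (0 < s)%N) (s_lt : (s < 2 * k)%N) (s_coprime : gcdn s (2 * k) = 1%N)
    (eta_nonsquare : ~ exists z : L, eta = z ^+ 2) :
  is_maximum_linear_code (n - 2) (Tcode K k s eta) /\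
  [/\ Tcode K k s eta \subset sym_bilforms L,
      submod_closed (Tcode K k s eta),
      #|Tcode K k s eta| = (q ^ (2 * n))%N &
      forall B : bilform L, B \in Tcode K k s eta -> B != 0 ->
        (n - 2 <= bfrank B)%N].
Proof.
have k_gt2 : (2 < k)%N by move: hk; rewrite !inE => /or3P[] /eqP->.
have co : coprime s (2 * k) by rewrite /coprime s_coprime.
subst q; have nE : \dim {:L} = (2 * k)%N by rewrite dimL.
have sym := Tcode_sub_sym s eta nE dimK.
have lin := Tcode_submod_closed K k s eta.
have card := card_Tcode q_odd nE dimK (ltnW k_gt2) co eta_nonsquare.
have rank := Tcode_rank q_odd nE dimK (ltnW k_gt2) co eta_nonsquare.
rewrite dimL in card rank; split=> //; split=> //.
have zmod : zmod_closed (Tcode K k s eta) := GRing.submod_closedB lin.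
have q1 : (1 < #|F|)%N := finNzRing_gt1 F.
split=> //.
- split=> //; first by rewrite card -(expn0 #|F|) ltn_exp2l // hn; lia.
  by move=> A B AC BC AB; apply: rank; rewrite ?subr_eq0 //; apply: zmod.2.
(* Here [n - d = 2] is even, and the bound has exponent [n * 4 / 2]. *)
- rewrite card /max_code_size dimL.
  have -> : (n - (n - 2) = 2)%N by rewrite hn; lia.
  by congr (_ ^ _)%N; lia.
Qed.
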